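(* Let $K$ be an algebraically closed field of characteristic zero. The Artinian algebra $A=K[X,Y,Z]/(X^3,Y^3,Z^3,XYZ)$ does not have the Weak Lefschetz property.
   Context: Let $R=K[X,Y,Z]$ with its standard grading. An Artinian graded $R$-algebra $A=R/I=K\oplus A_1\oplus\cdots\oplus A_s$ ($I$ a homogeneous ideal) has the Weak Lefschetz property if for every general linear form $\ell\in R_1$ (i.e. for all $\ell$ in some nonempty Zariski-open subset of $R_1$) the multiplication maps $A_m\to A_{m+1}$, $x\mapsto\ell x$, have maximal rank (are injective or surjective) for $m=0,\ldots,s-1$. *)

(* Defs.v *)
From HB Require Import structures.
From mathcomp Require Import all_boot all_order all_algebra.
From mathcomp Require Export mpoly.
From mathcomp Require Import boolp.

Set Implicit Arguments.
Unset Strict Implicit.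
Unset Printing Implicit Defensive.

Import GRing.Theory.

Local Open Scope ring_scope.
Local Open Scope quotient_scope.

(* Ideal generated by the finite sequence s; membership is made boolean by
   classical reflection so that ring_quotient applies. *)
Definition ideal_gen (R : comNzRingType) (s : seq R) : pred R :=
  fun f => `[< exists c : 'I_(size s) -> R, f = \sum_(i < size s) c i * s`_i >].

Lemma ideal_gen_idealr (R : comNzRingType) (s : seq R) :
  1 \notin ideal_gen s -> idealr_closed (ideal_gen s).
Proof.
move=> s1; split=> //.
  apply/asboolP; exists (fun=> 0).
  by rewrite big1 // => i _; rewrite mul0r.
move=> a _ _ /asboolP[c ->] /asboolP[d ->]; apply/asboolP.
exists (fun i => a * c i + d i).
rewrite mulr_sumr -big_split /=; apply: eq_bigr => i _.
by rewrite mulrDl mulrA.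
Qed.

(* The grading of A = R/I is the image of the standard grading of R; it is
   only meaningful for a homogeneous ideal I. *)
Definition graded_piece (K : fieldType) (I : idealr {mpoly K[3]}) (m : nat)
    (x : {ideal_quot I}) : Prop :=
  exists2 f : {mpoly K[3]}, f \is m.-homog & x = \pi f.

(* A = A_0 (+) ... (+) A_s with A_s <> 0, which determines s. *)
Definition artinian_grading (K : fieldType) (I : idealr {mpoly K[3]})
    (s : nat) : Prop :=
  (forall x : {ideal_quot I},
     exists! c : {ffun 'I_s.+1 -> {ideal_quot I}},
       (forall m : 'I_s.+1, graded_piece m (c m)) /\ x = \sum_(m < s.+1) c m) /\
  (exists2 x : {ideal_quot I}, graded_piece s x & x <> 0).

(* Zariski-open subsets of R_1, identified with affine 3-space through the
   coefficients l@_U_(i) of a linear form l: complements of the common zero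
   sets of arbitrary families F of polynomials. Only the restriction of U to
   R_1 matters. *)
Definition zariski_open_linear (K : fieldType) (U : {mpoly K[3]} -> Prop) :
    Prop :=
  exists F : {mpoly K[3]} -> Prop,
    forall l : {mpoly K[3]}, l \is 1.-homog ->
      (U l <-> exists2 g, F g & g.@[fun i => l@_U_(i)] != 0).

Definition mul_injective (K : fieldType) (I : idealr {mpoly K[3]})
    (l : {mpoly K[3]}) (m : nat) : Prop :=
  forall x y : {ideal_quot I}, graded_piece m x -> graded_piece m y ->
    \pi l * x = \pi l * y -> x = y.

Definition mul_surjective (K : fieldType) (I : idealr {mpoly K[3]})
    (l : {mpoly K[3]}) (m : nat) : Prop :=
  forall y : {ideal_quot I}, graded_piece m.+1 y ->
    exists2 x : {ideal_quot I}, graded_piece m x & \pi l * x = y.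

(* The property is only meant for Artinian graded R/I. As s ranges under a
   universal quantifier, the negation of weak_lefschetz I entails that R/I
   does have such a grading. *)
Definition weak_lefschetz (K : fieldType) (I : idealr {mpoly K[3]}) : Prop :=
  forall s : nat, artinian_grading I s ->
    exists U : {mpoly K[3]} -> Prop,
      [/\ zariski_open_linear U,
          (exists2 l : {mpoly K[3]}, l \is 1.-homog & U l)
        & forall l : {mpoly K[3]}, l \is 1.-homog -> U l ->
            forall m : nat, (m < s)%N ->
              mul_injective I l m \/ mul_surjective I l m].

Section MonomialIdeal.
Variable K : fieldType.

Let X : {mpoly K[3]} := 'X_(inord 0).
Let Y : {mpoly K[3]} := 'X_(inord 1).
Let Z : {mpoly K[3]} := 'X_(inord 2).

Definition cubes_xyz : pred {mpoly K[3]} :=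
  ideal_gen [:: X ^+ 3; Y ^+ 3; Z ^+ 3; X * Y * Z].

Lemma cubes_xyz_idealr : idealr_closed cubes_xyz.
Proof.
apply/ideal_gen_idealr/asboolP => -[c /(congr1 (meval (fun=> 0)))].
rewrite meval1 !big_ord_recl big_ord0 /= /X /Y /Z !exprS.
rewrite !(mevalD, mevalM, mevalXU, meval0) !(mul0r, mulr0) !addr0.
by move/eqP; rewrite oner_eq0.
Qed.

HB.instance Definition _ :=
  isIdealr.Build {mpoly K[3]} cubes_xyz cubes_xyz_idealr.

End MonomialIdeal.

Definition cubes_xyz_ideal (K : fieldType) : idealr {mpoly K[3]} :=
  @cubes_xyz K.

(* Main.v *)
(** Multiplication by l = aX + bY + cZ from A_2 to A_3, both of dimension 6, is
    never bijective. From
      l * (a^2 X^2 + b^2 Y^2 + c^2 Z^2 - abXY - bcYZ - acXZ)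
        = a^3 X^3 + b^3 Y^3 + c^3 Z^3 - 3abc XYZ
    the quadric factor is a nonzero element of the kernel when l <> 0. Dually, a
    nonzero functional on A_3 that vanishes on l A_2 can be written down
    explicitly. Both facts hold for every l, so no open set of linear forms has
    to be examined. *)

Require Import Defs.
From HB Require Import structures.
From mathcomp Require Import all_boot all_order all_algebra.
From mathcomp Require Import boolp ring.

Set Implicit Arguments.
Unset Strict Implicit.
Unset Printing Implicit Defensive.

Import GRing.Theory.

Local Open Scope ring_scope.
Local Open Scope quotient_scope.

(** * Ideal membership and monomial ideals *)

Lemma mem_ideal_gen (R : comNzRingType) (s : seq R) (x : R) :
  x \in s -> x \in ideal_gen s.
Proof.
move=> xs; apply/asboolP; exists (fun i => (i == index x s :> nat)%:R).
have lt_is : (index x s < size s)%N by rewrite index_mem.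
rewrite (bigD1 (Ordinal lt_is)) //= eqxx mul1r nth_index // big1 ?addr0 //.
by move=> i; rewrite -val_eqE /= => /negPf ->; rewrite mul0r.
Qed.

Lemma eq_piP (R : comNzRingType) (I : idealr R) (f g : R) :
  \pi_({ideal_quot I}) f = \pi g <-> f - g \in I.
Proof. by rewrite (Quotient.idealrBE I); split=> /eqP. Qed.

Section MonomialMultiples.
Variables (n : nat) (R : comNzRingType).
Implicit Types (p : {mpoly R[n]}) (m k : 'X_{1..n}) (gs : seq 'X_{1..n}).

Lemma mcoeff_mulX p m k :
  (p * 'X_[m])@_k = if (m <= k)%MM then p@_(k - m) else 0.
Proof.
case: ifP => [le_mk|nle_mk]; first by rewrite -{1}(submK le_mk) addmC mcoeffMX.
rewrite mcoeffM big1 // => -[k1 k2] /= /eqP Ek.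
rewrite mcoeffX; case: eqP => [Em|_]; last by rewrite mulr0.
by rewrite Ek Em lem_addl in nle_mk.
Qed.

(** A multiple of ['X_[g]] has zero coefficient at every monomial that [g] does not divide, and so
    has a sum of such multiples when no generator divides [m]. *)
Lemma mcoeff_monomial_ideal gs p m :
  p \in ideal_gen [seq 'X_[g] | g <- gs] -> p@_m != 0 ->
  has (fun g => (g <= m)%MM) gs.
Proof.
move=> /asboolP[c ->]; apply: contraR => /hasPn nle_gm.
rewrite raddf_sum /= big1 // => i _.
have lt_i : (i < size gs)%N by rewrite -(size_map (fun g => 'X_[R, g])).
rewrite (nth_map 0%MM) // mcoeff_mulX ifN //.
by apply: nle_gm; rewrite mem_nth.
Qed.

Lemma mcoeff_pihomog d p m :
  (pihomog mdeg d p)@_m = if mdeg m == d then p@_m else 0.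
Proof.
have [deg_m|ndeg_m] := eqVneq; last first.
  exact: dhomog_nemf_coeff (pihomogP _ d p) ndeg_m.
rewrite pihomogE raddf_sum [in RHS](mpolyE p) raddf_sum /= big_mkcond.
apply: eq_bigr => m' _; case: eqVneq => // ndeg_m'.
rewrite mcoeffZ mcoeffX; case: eqP => [Em|_]; last by rewrite mulr0.
by rewrite Em deg_m eqxx in ndeg_m'.
Qed.

End MonomialMultiples.

(** * Monomials in three variables as exponent triples *)

Definition mnm3 (i j k : nat) : 'X_{1..3} := [multinom [tuple i; j; k]].

Lemma ord3P (P : 'I_3 -> Prop) :
  P (inord 0) -> P (inord 1) -> P (inord 2) -> forall i, P i.
Proof.
move=> P0 P1 P2 i; rewrite -(inord_val i).
by case: i => -[|[|[|]]].
Qed.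

Lemma mnm3E i j k :
  ((mnm3 i j k (inord 0) = i) * (mnm3 i j k (inord 1) = j)
   * (mnm3 i j k (inord 2) = k))%type.
Proof. by rewrite /mnm3 !multinomE !(tnth_nth 0%N) /= !inordK. Qed.

Lemma mnm3_eta (m : 'X_{1..3}) : m = mnm3 (m (inord 0)) (m (inord 1)) (m (inord 2)).
Proof. by apply/mnmP; apply: ord3P; rewrite mnm3E. Qed.

Lemma mnm3D i j k i' j' k' :
  (mnm3 i j k + mnm3 i' j' k')%MM = mnm3 (i + i') (j + j') (k + k').
Proof. by apply/mnmP; apply: ord3P; rewrite mnmDE !mnm3E. Qed.

Lemma mnm3B i j k i' j' k' :
  (mnm3 i j k - mnm3 i' j' k')%MM = mnm3 (i - i') (j - j') (k - k').
Proof. by apply/mnmP; apply: ord3P; rewrite mnmBE !mnm3E. Qed.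

Lemma mnm3_le i j k i' j' k' :
  (mnm3 i j k <= mnm3 i' j' k')%MM = [&& i <= i', j <= j' & k <= k']%N.
Proof.
apply/mnm_lepP/and3P => [le_m|[? ? ?]]; last by apply: ord3P; rewrite !mnm3E.
by split; [have := le_m (inord 0)|have := le_m (inord 1)|have := le_m (inord 2)];
  rewrite !mnm3E.
Qed.

Lemma mnm3_eq i j k i' j' k' :
  (mnm3 i j k == mnm3 i' j' k') = [&& i == i', j == j' & k == k'].
Proof.
apply/eqP/and3P => [/mnmP eq_m|[/eqP-> /eqP-> /eqP->]//].
by split; apply/eqP;
  [have := eq_m (inord 0)|have := eq_m (inord 1)|have := eq_m (inord 2)];
  rewrite !mnm3E.
Qed.

Lemma mdeg_mnm3 i j k : mdeg (mnm3 i j k) = (i + j + k)%N.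
Proof.
rewrite (mdegE (mnm3 i j k)) !big_ord_recl big_ord0 addn0 addnA.
by rewrite /mnm3 !multinomE !(tnth_nth 0%N).
Qed.

Lemma mnmU3 : ((U_(inord 0) = mnm3 1 0 0) * (U_(inord 1) = mnm3 0 1 0)
  * (U_(inord 2) = mnm3 0 0 1))%MM%type.
Proof.
by split; [split|]; apply/mnmP; apply: ord3P;
  rewrite mnm1E mnm3E -val_eqE /= !inordK.
Qed.

(** * The ideal (X^3, Y^3, Z^3, XYZ) and the grading of its quotient *)

Section CubesXYZ.
Variable K : fieldType.
Implicit Types (f l q : {mpoly K[3]}).
Local Notation I := (cubes_xyz_ideal K).
Local Notation A := {ideal_quot I}.

(** Divisibility of X^i Y^j Z^k by a generator, in a form that computes on concrete exponents. *)
Definition cubes_xyz_monomial (i j k : nat) :=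
  [|| 2 < i, 2 < j, 2 < k | [&& 0 < i, 0 < j & 0 < k]]%N.

Definition cubes_xyz_mnms : seq 'X_{1..3} :=
  [:: mnm3 3 0 0; mnm3 0 3 0; mnm3 0 0 3; mnm3 1 1 1].

Lemma mem_cubes_xyz f :
  (f \in I) = (f \in ideal_gen [seq 'X_[K, g] | g <- cubes_xyz_mnms]).
Proof.
rewrite /= /cubes_xyz !mnmU3 !mpolyXn -!mpolyXD.
by rewrite !mulmS mulm0n !addm0 !mnm3D.
Qed.

Lemma has_cubes_xyz_mnms i j k :
  has (fun g => (g <= mnm3 i j k)%MM) cubes_xyz_mnms = cubes_xyz_monomial i j k.
Proof. by rewrite /= !mnm3_le /= !andbT orbF. Qed.

(** The ideal is monomial, so membership is tested one coefficient at a time; conversely, each term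
    divisible by a generator is itself a member. *)
Lemma cubes_xyzP f :
  reflect (forall i j k, f@_(mnm3 i j k) != 0 -> cubes_xyz_monomial i j k)
          (f \in I).
Proof.
apply: (iffP idP) => [fI i j k nz_f|f_mon].
  rewrite -has_cubes_xyz_mnms; apply: mcoeff_monomial_ideal nz_f.
  by rewrite -mem_cubes_xyz.
rewrite (mpolyE f) big_seq; apply: rpred_sum => m.
rewrite mcoeff_msupp -mul_mpolyC {1 3}(mnm3_eta m) => /f_mon.
rewrite -has_cubes_xyz_mnms => /hasP[g gs le_gm].
rewrite -(submK le_gm) mpolyXD mulrA; apply: idealMr.
by rewrite mem_cubes_xyz; apply/mem_ideal_gen/map_f.
Qed.

Lemma pihomog_cubes_xyz d f : f \in I -> pihomog mdeg d f \in I.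
Proof.
move=> /cubes_xyzP f_mon; apply/cubes_xyzP => i j k.
by rewrite mcoeff_pihomog; case: ifP => [_ /f_mon|_ /eqP].
Qed.

Lemma cubes_xyz_artinian : artinian_grading I 4.
Proof.
split=> [x|].
  exists [ffun d : 'I_5 => \pi_A (pihomog mdeg d (repr x))]; split.
    split=> [d|].
      by rewrite ffunE; exists (pihomog mdeg d (repr x)) => //; apply: pihomogP.
    under eq_bigr do rewrite ffunE.
    rewrite -raddf_sum -{1}(reprK x) /=; apply/eq_piP/cubes_xyzP => i j k.
    apply: contraR => not_mon; rewrite mcoeffB raddf_sum /= subr_eq0; apply/eqP.
    (* A monomial outside the ideal has exponents at most 2, one of them 0, hence degree at most 4;
       X^2 Y^2 attains this bound. *)
    have lt_deg5 : (mdeg (mnm3 i j k) < 5)%N.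
      rewrite mdeg_mnm3; move: not_mon.
      by case: i j k => [|[|[|i]]] [|[|[|j]]] [|[|[|k]]].
    rewrite (bigD1 (Ordinal lt_deg5)) //= mcoeff_pihomog eqxx big1 ?addr0 //.
    move=> d; rewrite -val_eqE /= mcoeff_pihomog eq_sym; exact: ifN.
  move=> c [/fin_all_exists2[g hom_g c_g] x_c]; apply/ffunP => d.
  rewrite ffunE c_g; apply/eq_piP.
  (* Uniqueness: [g d] is the degree [d] projection of the sum of all [g e]. That sum is congruent
     to [repr x], and projection preserves the ideal. *)
  rewrite -{1}[g d](pihomog_dE (hom_g d)).
  have -> : pihomog mdeg d (g d) = pihomog mdeg d (\sum_e g e).
    rewrite raddf_sum (bigD1 d) //= big1 ?addr0 // => e ne_ed.
    by rewrite (pihomog_ne0 _ (hom_g e)).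
  rewrite -raddfB; apply: pihomog_cubes_xyz; apply/eq_piP.
  by rewrite reprK x_c raddf_sum; apply: eq_bigr => e _; rewrite c_g.
exists (\pi_A 'X_[mnm3 2 2 0]).
  by exists 'X_[mnm3 2 2 0] => //; rewrite dhomogX; apply/eqP/mdeg_mnm3.
rewrite -(raddf0 \pi_A) => /eq_piP; rewrite subr0 => /cubes_xyzP/(_ 2 2 0)%N.
by rewrite mcoeffX eqxx oner_eq0 => /(_ isT).
Qed.

Lemma linear_formE l : l \is 1.-homog ->
  l = l@_(mnm3 1 0 0) *: 'X_[mnm3 1 0 0] + l@_(mnm3 0 1 0) *: 'X_[mnm3 0 1 0]
      + l@_(mnm3 0 0 1) *: 'X_[mnm3 0 0 1].
Proof.
move=> hom_l; apply/mpolyP => m; rewrite !mcoeffD !mcoeffZ !mcoeffX.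
have [/mdeg1P[i /eqP->]|nm1] := boolP (mdeg m == 1%N).
  by elim/ord3P: i; rewrite mnmU3 !mnm3_eq /= !(mulr0, mulr1, addr0, add0r).
rewrite (dhomog_nemf_coeff hom_l nm1).
have neq_m i j k : (i + j + k)%N = 1%N -> (mnm3 i j k == m) = false.
  by move=> d1; apply: contraNF nm1 => /eqP<-; rewrite mdeg_mnm3 d1.
by rewrite !neq_m // !mulr0 !addr0.
Qed.

Lemma not_mul_injective_of_kernel m l q :
  q \is m.-homog -> q \notin I -> l * q \in I -> ~ mul_injective I l m.
Proof.
move=> hom_q /negP qI lqI inj; apply: qI; rewrite -[q]subr0; apply/eq_piP.
apply: inj; first by exists q.
  by exists 0 => //; apply: dhomog0.
by rewrite -!rmorphM mulr0; apply/eq_piP; rewrite subr0.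
Qed.

(** This is the classical factorization of u^3 + v^3 + w^3 - 3uvw by u + v + w, at u = aX, v = bY, w
    = cZ. *)
Lemma mul_kernel_cubesE a b c (X Y Z : {mpoly K[3]}) :
  (a *: X + b *: Y + c *: Z)
    * (a ^+ 2 *: X ^+ 2 + b ^+ 2 *: Y ^+ 2 + c ^+ 2 *: Z ^+ 2
       - (a * b) *: (X * Y) - (b * c) *: (Y * Z) - (a * c) *: (X * Z))
  = a ^+ 3 *: X ^+ 3 + b ^+ 3 *: Y ^+ 3 + c ^+ 3 *: Z ^+ 3
    - (3 * a * b * c) *: (X * Y * Z).
Proof. by rewrite -!mul_mpolyC; ring. Qed.

Lemma cubes_xyz_not_mul_injective l : l \is 1.-homog -> ~ mul_injective I l 2.
Proof.
move=> /linear_formE.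
move: l@__ l@__ l@__ => c b a l_E.
have ZI x g : g \in cubes_xyz_mnms -> x *: 'X_[g] \in I.
  move=> gs; rewrite -mul_mpolyC; apply: idealMr.
  by rewrite mem_cubes_xyz; apply/mem_ideal_gen/map_f.
(* For [l = 0] the quadric of the identity vanishes too, so X^2 serves as kernel element instead. *)
have [l0|nz_l] := eqVneq l 0.
  apply: (@not_mul_injective_of_kernel _ _ 'X_[mnm3 2 0 0]).
  - by rewrite dhomogX; apply/eqP/mdeg_mnm3.
  - by apply/cubes_xyzP => /(_ 2 0 0)%N; rewrite mcoeffX eqxx oner_eq0 => /(_ isT).
  - by rewrite l0 mul0r; apply: idealr0.
pose q : {mpoly K[3]} :=
  a ^+ 2 *: 'X_[mnm3 2 0 0] + b ^+ 2 *: 'X_[mnm3 0 2 0] + c ^+ 2 *: 'X_[mnm3 0 0 2]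
  - (a * b) *: 'X_[mnm3 1 1 0] - (b * c) *: 'X_[mnm3 0 1 1]
  - (a * c) *: 'X_[mnm3 1 0 1].
have [[q200 q020] q002] : ((q@_(mnm3 2 0 0) = a ^+ 2) * (q@_(mnm3 0 2 0) = b ^+ 2)
    * (q@_(mnm3 0 0 2) = c ^+ 2))%type.
  by split; [split|]; rewrite /q !mcoeffB !mcoeffD !mcoeffZ !mcoeffX !mnm3_eq /=
    !mulr0 !mulr1 !subr0 ?addr0 ?add0r.
apply: (@not_mul_injective_of_kernel _ _ q).
- by rewrite !(rpredB, rpredD, rpredZ) // dhomogX; apply/eqP/mdeg_mnm3.
(* X^2, Y^2, Z^2 lie outside the ideal, so [q] in the ideal would force a^2 = b^2 = c^2 = 0. *)
- apply: contra nz_l => /cubes_xyzP q_mon; rewrite l_E.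
  have sqr0 x i j k : q@_(mnm3 i j k) = x ^+ 2 -> ~~ cubes_xyz_monomial i j k ->
      x = 0.
    move=> Ex; apply: contraNeq => nz_x.
    by apply: q_mon; rewrite Ex expf_eq0.
  by rewrite (sqr0 a _ _ _ q200) // (sqr0 b _ _ _ q020) // (sqr0 c _ _ _ q002) //
    !scale0r !addr0.
- have -> : l * q = a ^+ 3 *: 'X_[mnm3 3 0 0] + b ^+ 3 *: 'X_[mnm3 0 3 0]
      + c ^+ 3 *: 'X_[mnm3 0 0 3] - (3 * a * b * c) *: 'X_[mnm3 1 1 1].
    have := mul_kernel_cubesE a b c 'X_[mnm3 1 0 0] 'X_[mnm3 0 1 0] 'X_[mnm3 0 0 1].
    by rewrite -l_E !mpolyXn -!mpolyXD !mulmS mulm0n !addm0 !mnm3D.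
  by rewrite !(rpredB, rpredD) //; apply: ZI; rewrite !inE eqxx ?orbT.
Qed.

(** * Failure of surjectivity from degree 2 to degree 3 *)

(* Solves the transpose of the 6x6 system describing multiplication by
   aX + bY + cZ from degree 2 to degree 3; w12 is the weight of X^2 Y, w21 that
   of X Y^2, and so on. The generic solution vanishes if two of a, b, c do. *)
Lemma cokernel_weights (a b c : K) :
  exists w : (K * K * K) * (K * K * K),
    let: (w12, w13, w21, (w23, w31, w32)) := w in
    w != 0 /\
    [/\ b * w12 + c * w13 = 0, a * w21 + c * w23 = 0 & a * w31 + b * w32 = 0] /\
    [/\ a * w12 + b * w21 = 0, b * w23 + c * w32 = 0 & a * w13 + c * w31 = 0].
Proof.
have [/and3P[]|nz_pair] := boolP [&& a * b == 0, a * c == 0 & b * c == 0].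
  rewrite !mulf_eq0 => ab0 ac0 bc0.
  have : [|| (a == 0) && (b == 0), (a == 0) && (c == 0) | (b == 0) && (c == 0)].
    by case: (a == 0) (b == 0) (c == 0) ab0 ac0 bc0 => [] [] [].
  (* Each weight occurs in just two equations, with two different coefficients among a, b, c. When
     both vanish, that weight is free and is set to 1. *)
  case/or3P=> /andP[/eqP-> /eqP->];
    [exists ((1, 0, 0), 0)|exists ((0, 1, 0), 0)|exists (0, (1, 0, 0))];
    by rewrite !xpair_eqE oner_eq0 ?andbF; do !split; rewrite /=; ring.
(* The equations link the weights in a six-cycle; starting from [w12] = bc^2, each link determines
   the next weight, and the cycle closes up. *)
exists ((b * c ^+ 2, - b ^+ 2 * c, - a * c ^+ 2),
        (a ^+ 2 * c, a * b ^+ 2, - a ^+ 2 * b)); split; last first.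
  by do !split; ring.
apply: contra nz_pair; rewrite !xpair_eqE.
case/andP=> /andP[/andP[bcc0 _] acc0] /andP[/andP[_ abb0] _].
move: bcc0 acc0 abb0; rewrite !mulf_eq0 !oppr_eq0.
by case: (a == 0) (b == 0) (c == 0) => [] [] [].
Qed.

Lemma cubes_xyz_not_mul_surjective l : l \is 1.-homog -> ~ mul_surjective I l 2.
Proof.
move=> /linear_formE.
move: l@__ l@__ l@__ => c b a l_E surj.
have [[[[w12 w13] w21] [[w23 w31] w32]]] := cokernel_weights a b c.
case=> nz_w [[eqXX eqYY eqZZ] [eqXY eqYZ eqXZ]].
(* The functional reads exactly the six cubic monomials outside the ideal, so it kills the ideal. *)
pose phi p : K := w12 * p@_(mnm3 2 1 0) + w13 * p@_(mnm3 2 0 1)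
  + w21 * p@_(mnm3 1 2 0) + w23 * p@_(mnm3 0 2 1)
  + w31 * p@_(mnm3 1 0 2) + w32 * p@_(mnm3 0 1 2).
have phi_mul q : phi (l * q) = 0.
  have lqE m : (l * q)@_m = a * (q * 'X_[mnm3 1 0 0])@_m
      + b * (q * 'X_[mnm3 0 1 0])@_m + c * (q * 'X_[mnm3 0 0 1])@_m.
    by rewrite mulrC l_E !mulrDr -!scalerAr !mcoeffD !mcoeffZ.
  rewrite /phi !lqE !mcoeff_mulX !mnm3_le /= !mnm3B !(subSS, subn0) !mulr0.
  move: q@_(mnm3 2 0 0) q@_(mnm3 0 2 0) q@_(mnm3 0 0 2) => qXX qYY qZZ.
  move: q@_(mnm3 1 1 0) q@_(mnm3 0 1 1) q@_(mnm3 1 0 1) => qXY qYZ qXZ.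
  (* Grouped by the quadratic coefficients of [q], each group is one of the six weight equations. *)
  transitivity (qXX * (b * w12 + c * w13) + qYY * (a * w21 + c * w23)
    + qZZ * (a * w31 + b * w32) + qXY * (a * w12 + b * w21)
    + qYZ * (b * w23 + c * w32) + qXZ * (a * w13 + c * w31)); first by ring.
  by rewrite eqXX eqYY eqZZ eqXY eqYZ eqXZ !mulr0 !addr0.
have phi_I p : p \in I -> phi p = 0.
  move=> /cubes_xyzP p_mon.
  have p0 i j k : ~~ cubes_xyz_monomial i j k -> p@_(mnm3 i j k) = 0.
    by move=> not_mon; apply/eqP; apply: contraNT not_mon => /p_mon.
  by rewrite /phi !p0 // !mulr0 !addr0.
(* Surjectivity makes every cubic monomial congruent to a multiple of [l], so [phi] kills it; its
   values at the six monomials are the weights, which cannot all vanish. *)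
have phi_X m : mdeg m = 3%N -> phi 'X_[m] = 0.
  move=> m3; have [|x [q _ ->]] := surj (\pi_A 'X_[m]).
    by exists 'X_[m] => //; rewrite dhomogX; apply/eqP.
  rewrite -rmorphM => /eq_piP/phi_I phi_sub.
  have -> : phi 'X_[m] = phi (l * q) - phi (l * q - 'X_[m]).
    by rewrite /phi !mcoeffB; ring.
  by rewrite phi_mul phi_sub subrr.
have phi_mnm i j k : (i + j + k)%N = 3%N -> phi 'X_[mnm3 i j k] = 0.
  by move=> d3; apply: phi_X; rewrite mdeg_mnm3.
have := (phi_mnm 2 1 0, phi_mnm 2 0 1, phi_mnm 1 2 0,
         phi_mnm 0 2 1, phi_mnm 1 0 2, phi_mnm 0 1 2)%N.
case=> [[[[[/(_ erefl) + /(_ erefl)] + /(_ erefl)] + /(_ erefl)]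
  + /(_ erefl)] + /(_ erefl)].
rewrite /phi !mcoeffX !mnm3_eq /= !mulr0 !mulr1 !addr0 !add0r.
move=> w12_0 w13_0 w21_0 w23_0 w31_0 w32_0; move: nz_w.
by rewrite w12_0 w13_0 w21_0 w23_0 w31_0 w32_0 eqxx.
Qed.

End CubesXYZ.

Theorem mainTheorem3 (K : closedFieldType) (charK0 : [pchar K] =i pred0) :
  ~ weak_lefschetz (cubes_xyz_ideal K).
Proof.
(* Nonemptiness of [U] supplies [l]; the property is contradicted at the map from degree 2 to degree
   3. *)
move=> /(_ _ (cubes_xyz_artinian K))[U [_ [l hom_l Ul] /(_ l hom_l Ul 2%N isT)]].
case; first exact: cubes_xyz_not_mul_injective.
exact: cubes_xyz_not_mul_surjective.
Qed.
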